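(* Let $q\in(0,1)$, $k>0$ and $L\ge 2$. The process ASIP$(q,k)$ on $\Lambda_L=\{1,\dots,L\}$ with closed boundary conditions is self-dual with self-duality function $$D_{(L)}(\eta,\xi)=\prod_{i=1}^L \frac{\binom{\eta_i}{\xi_i}_q}{\binom{\xi_i+2k-1}{\xi_i}_q}\; q^{(\eta_i-\xi_i)\left[2\sum_{m=1}^{i-1}\xi_m+\xi_i\right]-4ki\xi_i}\;\mathbf 1_{\xi_i\le\eta_i},\qquad \eta,\xi\in\mathbb N^{\Lambda_L},$$ or, equivalently, with self-duality function $$D'_{(L)}(\eta,\xi)=\prod_{i=1}^L \frac{(q^{2(\eta_i-\xi_i+1)};q^2)_{\xi_i}}{(q^{4k};q^2)_{\xi_i}}\; q^{(\xi_i-4ki+2N_{i+1}(\eta))\xi_i}\;\mathbf 1_{\xi_i\le\eta_i},\qquad N_i(\eta):=\sum_{j=i}^L\eta_j .$$ That is, for both $D=D_{(L)}$ and $D=D'_{(L)}$, for all $\eta,\xi\in\mathbb N^{\Lambda_L}$ and all $t>0$, $$\mathbb E_\eta\big[D(\eta(t),\xi)\big]=\mathbb E_\xi\big[D(\eta,\xi(t))\big],$$ where $\eta(t)$ and $\xi(t)$ are ASIP$(q,k)$ processes started from $\eta$ and $\xi$ respectively.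
   Context: $\mathbb N=\{0,1,2,\dots\}$. For real $a$, $[a]_q=\frac{q^a-q^{-a}}{q-q^{-1}}$. For integers, $[n]_q!=[n]_q[n-1]_q\cdots[1]_q$ and $\binom{n}{m}_q=\frac{[n]_q!}{[m]_q![n-m]_q!}$; moreover $\binom{n+2k-1}{n}_q=\prod_{m=1}^n\frac{[2k-1+m]_q}{[m]_q}$ (equal to $1$ for $n=0$). $(a;q)_m=(1-a)(1-aq)\cdots(1-aq^{m-1})$, with $(a;q)_0=1$. $N_{L+1}(\eta)=0$. For $\eta\in\mathbb N^{\Lambda_L}$ with $\eta_i>0$, $\eta^{i,j}$ is the configuration obtained from $\eta$ by removing one particle from site $i$ and putting it at site $j$. ASIP$(q,k)$ on $\Lambda_L$ with closed boundary conditions is the Markov jump process on $\mathbb N^{\Lambda_L}$ with generator $\sum_{i=1}^{L-1}\mathcal L_{i,i+1}$, $$(\mathcal L_{i,i+1}f)(\eta)=q^{\eta_i-\eta_{i+1}+(2k-1)}[\eta_i]_q[2k+\eta_{i+1}]_q\big(f(\eta^{i,i+1})-f(\eta)\big)+q^{\eta_i-\eta_{i+1}-(2k-1)}[2k+\eta_i]_q[\eta_{i+1}]_q\big(f(\eta^{i+1,i})-f(\eta)\big).$$ The total particle number is conserved, so from each initial configuration it is a finite state continuous time Markov chain. *)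

(* Defs.v *)
From mathcomp Require Import all_boot all_order all_algebra.
From mathcomp Require Import all_classical all_reals all_analysis.
Import Order.TTheory GRing.Theory Num.Theory.
Import numFieldNormedType.Exports.

Set Implicit Arguments.
Unset Strict Implicit.
Unset Printing Implicit Defensive.

Local Open Scope classical_set_scope.
Local Open Scope ring_scope.

Section MarkovJumpProcess.
Context {R : realType} {S : countType}.

(* The sigma-algebra generated by X_u, 0 <= u <= s. *)
Definition past {d} {T : measurableType d} (X : R -> T -> S) (s : R)
    : set (set T) :=
  <<s [set B | exists (u : R) (y : S), 0 <= u <= s /\ B = X u @^-1` [set y]] >>.

(* A Markov jump process on the discrete countable space S with generator
   [gen], as a family of laws [P x] (x the initial state) of one path-valued
   process [X]. Only the times t >= 0 are meaningful. The Markov property is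
   P_x(A, X_s = y, X_(s+t) = z) = P_x(A, X_s = y) P_y(X_t = z)
   for every event A of the past of s. *)
Record markov_jump_process (gen : (S -> R) -> S -> R)
    {d} {T : measurableType d} (P : S -> probability T R) (X : R -> T -> S)
    : Prop := MarkovJumpProcess {
  mjp_measurable : forall (t : R) y, 0 <= t -> measurable (X t @^-1` [set y]) ;
  mjp_right_continuous : forall w (t : R), 0 <= t ->
    \forall s \near t^'+, X s w = X t w ;
  mjp_left_limit : forall w (t : R), 0 < t ->
    exists y, \forall s \near t^'-, X s w = y ;
  mjp_start : forall x, P x (X 0 @^-1` [set x]) = 1%E ;
  mjp_markov : forall x (s t : R) A y z, 0 <= s -> 0 <= t -> past X s A ->
    P x (A `&` X s @^-1` [set y] `&` X (s + t) @^-1` [set z]) =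
    (P x (A `&` X s @^-1` [set y]) * P y (X t @^-1` [set z]))%E ;
  mjp_generator : forall (f : S -> R) x,
    (exists M : R, forall y, `|f y| <= M) ->
    (fine ('E_(P x)[f \o X t])%E - f x) / t @[t --> 0^'+] --> gen f x
}.

End MarkovJumpProcess.

Section QNumbers.
Context {R : realType}.
Implicit Types (q a k : R) (n m : nat).

Definition qnum q a : R := (q `^ a - q `^ (- a)) / (q - q^-1).

Definition qfact q n : R := \prod_(1 <= m < n.+1) qnum q m%:R.

(* Meaningful for m <= n only, since n - m is truncated. *)
Definition qbinom q n m : R := qfact q n / (qfact q m * qfact q (n - m)).

(* The q-binomial coefficient (n + 2k - 1 choose n), for real k. *)
Definition qbinom2k q k n : R :=
  \prod_(1 <= m < n.+1) (qnum q (2 * k - 1 + m%:R) / qnum q m%:R).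

Definition qpoch a q m : R := \prod_(0 <= j < m) (1 - a * q ^+ j).

End QNumbers.

(* Site i of {1, ..., L} is represented by the ordinal of value i - 1. *)
Definition config (L : nat) : countType := {ffun 'I_L -> nat}.

(* Relevant only when 0 < eta i and i != j; the rates of the generator vanish
   when the site left by the particle is empty. *)
Definition hop L (eta : config L) (i j : 'I_L) : config L :=
  [ffun l => (eta l - (l == i) + (l == j))%N].

Section ASIP.
Context {R : realType}.
Variables (q k : R) (L : nat).
Implicit Types (eta xi : config L).

Definition asip_bond (i j : 'I_L) (f : config L -> R) eta : R :=
  q `^ ((eta i)%:R - (eta j)%:R + (2 * k - 1))
    * qnum q (eta i)%:R * qnum q (2 * k + (eta j)%:R)
    * (f (hop eta i j) - f eta)
  + q `^ ((eta i)%:R - (eta j)%:R - (2 * k - 1))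
    * qnum q (2 * k + (eta i)%:R) * qnum q (eta j)%:R
    * (f (hop eta j i) - f eta).

Definition asip_generator (f : config L -> R) eta : R :=
  \sum_(i < L) \sum_(j < L | j == i.+1 :> nat) asip_bond i j f eta.

Definition asip_D eta xi : R :=
  \prod_(i < L)
    (qbinom q (eta i) (xi i) / qbinom2k q k (xi i)
     * q `^ (((eta i)%:R - (xi i)%:R)
               * (2 * \sum_(m < L | (m < i)%N) (xi m)%:R + (xi i)%:R)
             - 4 * k * i.+1%:R * (xi i)%:R)
     * ((xi i <= eta i)%N)%:R).

(* The number of particles strictly to the right of i; it is N_{i+1}(eta) when
   i also denotes the 1-based label of the site. *)
Definition num_right eta (i : 'I_L) : nat := \sum_(j < L | (i < j)%N) eta j.

Definition asip_D' eta xi : R :=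
  \prod_(i < L)
    (qpoch (q `^ (2 * ((eta i)%:R - (xi i)%:R + 1))) (q ^+ 2) (xi i)
       / qpoch (q `^ (4 * k)) (q ^+ 2) (xi i)
     * q `^ (((xi i)%:R - 4 * k * i.+1%:R + 2 * (num_right eta i)%:R)
             * (xi i)%:R)
     * ((xi i <= eta i)%N)%:R).

End ASIP.

(* Main.v *)
Require Import Defs.
From mathcomp Require Import all_boot all_order all_algebra.
From mathcomp Require Import all_classical all_reals all_analysis.
From mathcomp Require Import measurable_realfun.
From mathcomp Require Import ring lra zify.
Import Order.TTheory GRing.Theory Num.Theory.
Import numFieldNormedType.Exports.

(* Up to factors depending on [xi] only through the conserved total particle
   number, both duality functions equal
     prod_i w(eta_i, xi_i) * q^(sum_i xi_i (eta_i + 2 N_{i+1}(eta) - 4 k i)),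
   where w(a, x) = ([a]...[a-x+1]) / ([2k]...[2k+x-1]) vanishes for x > a. A
   jump across a bond changes this product only at the two sites of the bond,
   so the duality of the generators reduces to a rational identity in q, q^(2k)
   and the q-powers of the four occupation numbers.

   Particles are conserved almost surely: the generator kills the indicator of
   the finite set of configurations with n particles, so the mass leaving it
   during a time step h is o(h), and the Markov property sums t/h such errors.
   Write u(s, r) = E[D(eta(s), xi(r))] for independent processes. The duality of
   the generators gives u(s + h, r) - u(s, r + h) = o(h), uniformly in s and r,
   so t/h such steps give u(t, 0) = u(0, t). *)

Set Implicit Arguments.
Unset Strict Implicit.
Unset Printing Implicit Defensive.

Local Open Scope classical_set_scope.
Local Open Scope ring_scope.

(** * Duality of the generators *)

(* Here [Q, A, B, X, Y, K] are the powers of q with exponents 1, eta_i, eta_(i+1),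
   xi_i, xi_(i+1), 2k. *)
Lemma two_site_identity (F : fieldType) (Q A B X Y K : F)
    (n := fun z : F => (z - z^-1) / (Q - Q^-1)) :
    Q != 0 -> Q * Q - 1 != 0 -> A != 0 -> B != 0 -> X != 0 -> Y != 0 -> K != 0 ->
  A / B * (K / Q) * n (K * B)
    * (n (A / X * Q) * n (A / X) * (n (B * Q) * (X * Y))
       - n A * (n (A / X * Q) * n (B / Y * Q)))
  + A / B / (K / Q) * n (K * A)
    * (n (A * Q) * (n (B / Y * Q) * n (B / Y)) / (X * Y)
       - n B * (n (A / X * Q) * n (B / Y * Q)))
  = X / Y * (K / Q)
    * (n X * n (K * X / Q) * (n (B / Y * Q) * n (B / Y)) / (A * B * (K * K))
       - n X * n (K * Y) * (n (A / X * Q) * n (B / Y * Q)))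
  + X / Y / (K / Q)
    * (n (A / X * Q) * n (A / X) * (n Y * n (K * Y / Q)) * (A * B * (K * K))
       - n (K * X) * n Y * (n (A / X * Q) * n (B / Y * Q))).
Proof.
by move=> Q0 Q1 A0 B0 X0 Y0 K0; rewrite /n; field; rewrite Q0 Q1 A0 B0 X0 Y0 K0.
Qed.

(** * q-numbers and the single-site weight *)

Section QAlgebra.
Context {R : realType}.
Variables (q k : R).
Hypotheses (q01 : 0 < q < 1) (k_gt0 : 0 < k).

Let q_gt0 : 0 < q. Proof. by case/andP: q01. Qed.
Let q_neq0 : q != 0. Proof. exact: lt0r_neq0. Qed.

Lemma powR_baseD x y : q `^ (x + y) = q `^ x * q `^ y.
Proof. by rewrite powRD// q_neq0 implybT. Qed.

Lemma powR_baseB x y : q `^ (x - y) = q `^ x / q `^ y.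
Proof. by rewrite powR_baseD powRN. Qed.

Lemma powR_base_sum (I : finType) (f : I -> R) :
  q `^ (\sum_i f i) = \prod_i q `^ (f i).
Proof. exact: (big_morph _ powR_baseD (powRr0 q)). Qed.

Lemma powR_base_neq0 x : q `^ x != 0.
Proof. by rewrite lt0r_neq0// powR_gt0. Qed.

Lemma qnumE x : qnum q x = (q `^ x - (q `^ x)^-1) / (q - q^-1).
Proof. by rewrite /qnum powRN. Qed.

Lemma qsq_neq1 : q * q - 1 != 0.
Proof. by case/andP: q01 => q0 q1; apply/eqP; nra. Qed.

Lemma qnum0 : qnum q 0 = 0.
Proof. by rewrite /qnum oppr0 subrr mul0r. Qed.

Lemma qnum_neq0 x : 0 < x -> qnum q x != 0.
Proof.
move=> x0; rewrite /qnum mulf_neq0 ?invr_eq0//.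
  rewrite subr_eq0 /powR (negPf q_neq0) (inj_eq (@expR_inj R)).
  rewrite mulNr eq_sym eqNr mulf_neq0 ?(gt_eqF x0)//.
  by rewrite lt_eqF// ln_lt0.
have := qsq_neq1; apply: contra_neq => qV.
have -> : q * q - 1 = q * (q - q^-1) by rewrite mulrBr divff.
by rewrite qV mulr0.
Qed.

(** The difference is taken in [R]: for [x > a] one factor is [qnum q 0], so the product vanishes
    and carries the indicator of [x <= a]. *)
Definition qfall a x : R := \prod_(j < x) qnum q (a%:R - j%:R).

Definition qrise x : R := \prod_(j < x) qnum q (2 * k + j%:R).

Definition weight a x := qfall a x / qrise x.

Lemma qfallSr a x : qfall a x.+1 = qfall a x * qnum q (a%:R - x%:R).
Proof. by rewrite /qfall big_ord_recr. Qed.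

Lemma qfallSS a x : qfall a.+1 x.+1 = qnum q a.+1%:R * qfall a x.
Proof.
rewrite /qfall big_ord_recl subr0; congr (_ * _).
by apply: eq_bigr => j _; rewrite lift0 -!natr1; congr qnum; lra.
Qed.

Lemma qriseS x : qrise x.+1 = qrise x * qnum q (2 * k + x%:R).
Proof. by rewrite /qrise big_ord_recr. Qed.

Lemma qnum2k_neq0 x : qnum q (2 * k + x%:R) != 0.
Proof. by rewrite qnum_neq0// ltr_wpDr// mulr_gt0. Qed.

Lemma qrise_neq0 x : qrise x != 0.
Proof. by apply/prodf_neq0 => j _; exact: qnum2k_neq0. Qed.

(* [u] is [qfall a x.-1 / qrise x], and for [x = 0] its analytic continuation
   [1 / [a + 1]]; it avoids dividing by [[a - x + 1]], which may vanish. *)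
Lemma weight_neighbours a x : exists u,
  [/\ weight a x = u * qnum q (a%:R - x%:R + 1),
      qnum q (2 * k + x%:R) * weight a x.+1 =
        u * qnum q (a%:R - x%:R + 1) * qnum q (a%:R - x%:R),
      qnum q x%:R * weight a x.-1 =
        qnum q x%:R * qnum q (2 * k + x%:R - 1) * u,
      weight a.+1 x = qnum q (a%:R + 1) * u &
      qnum q a%:R * weight a.-1 x =
        u * qnum q (a%:R - x%:R + 1) * qnum q (a%:R - x%:R)].
Proof.
have [u [E1 E2 E3 E4]] : exists u,
  [/\ qfall a x = u * qnum q (a%:R - x%:R + 1),
      qnum q x%:R * qfall a x.-1 = qnum q x%:R * u,
      qfall a.+1 x = qnum q (a%:R + 1) * u &
      qnum q a%:R * qfall a.-1 x =
        u * qnum q (a%:R - x%:R + 1) * qnum q (a%:R - x%:R)].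
  case: x => [|x].
    exists (qnum q (a%:R + 1))^-1; rewrite /qfall !big_ord0 !subr0 qnum0 !mul0r.
    by rewrite natr1 mulVf ?divff ?mul1r ?mulr1// qnum_neq0.
  exists (qfall a x); rewrite qfallSS qfallSr natr1.
  rewrite -natr1 (_ : a%:R - (x%:R + 1) + 1 = a%:R - x%:R); last by lra.
  split=> //; case: a => [|a].
    (* For [a = 0] the left side has the factor [qnum q 0]; the right side has the same zero, either
       as an explicit factor or inside [qfall]. *)
    rewrite qnum0 !mul0r; case: x => [|x]; last first.
      by rewrite /qfall big_ord_recl subrr qnum0 !mul0r.
    by rewrite subrr qnum0 mulr0 mul0r.
  by rewrite -qfallSS !qfallSr -!natr1 mulrA.
have r0 := qrise_neq0 x.
exists (u / qrise x); rewrite /weight E1 E3; split.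
- by field.
- rewrite qfallSr E1 qriseS; field; rewrite r0; exact: qnum2k_neq0.
- case: x r0 E2 {E1 E3 E4} => [|x] r0 E2; first by rewrite qnum0 !mul0r.
  rewrite mulrA E2 qriseS -natr1.
  rewrite (_ : 2 * k + (x%:R + 1) - 1 = 2 * k + x%:R); last by lra.
  by field; rewrite qrise_neq0 qnum2k_neq0.
- by field.
- by rewrite mulrA E4; field.
Qed.

End QAlgebra.

Section Hop.
Context {L : nat}.
Implicit Types (eta : config L) (i j l : 'I_L).

Lemma hop_src eta i j : i != j -> hop eta i j i = (eta i).-1.
Proof. by move=> ij; rewrite ffunE eqxx (negPf ij) addn0 subn1. Qed.

Lemma hop_dst eta i j : i != j -> hop eta i j j = (eta j).+1.
Proof. by move=> ij; rewrite ffunE eqxx eq_sym (negPf ij) subn0 addn1. Qed.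

Lemma hop_off eta i j l : l != i -> l != j -> hop eta i j l = eta l.
Proof. by move=> /negPf li /negPf lj; rewrite ffunE li lj subn0 addn0. Qed.

(** A nonempty source makes the truncated subtraction in [hop] exact, so a jump adds a signed pair
    of indicators. *)
Lemma natr_hop (R : pzRingType) eta i j l : (0 < eta i)%N ->
  (hop eta i j l)%:R = (eta l)%:R + ((l == j)%:R - (l == i)%:R) :> R.
Proof.
move=> i0; rewrite ffunE natrD natrB; last by case: eqP => [->|].
by rewrite addrAC addrA.
Qed.

End Hop.

Lemma sum_natr_eq (R : pzSemiRingType) (I : finType) (P : pred I) (j : I) :
  \sum_(m | P m) (m == j)%:R = (P j)%:R :> R.
Proof.
rewrite big_mkcond (bigD1 j)//= eqxx big1 ?addr0; first by case: (P j).
by move=> m /negPf ->; case: (P m).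
Qed.

Lemma sum_mulr_natr_eq (R : pzRingType) (I : finType) (f : I -> R) (j : I) :
  \sum_m f m * (m == j)%:R = f j.
Proof.
rewrite (bigD1 j)//= eqxx mulr1 big1 ?addr0// => m /negPf ->.
by rewrite mulr0.
Qed.

(** * The duality kernel across one bond *)

Section Duality.
Context {R : realType}.
Variables (q k : R) (L : nat).
Hypotheses (q01 : 0 < q < 1) (k_gt0 : 0 < k).
Implicit Types (eta xi : config L) (i j l : 'I_L).

Local Notation w := (weight q k).

Definition dual_exponent eta xi : R :=
  \sum_l (xi l)%:R *
    ((eta l)%:R + 2 * \sum_(m < L | (l < m)%N) (eta m)%:R - 4 * k * l.+1%:R).

Definition dual_kernel eta xi :=
  (\prod_l w (eta l) (xi l)) * q `^ dual_exponent eta xi.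

Lemma dual_exponent_hopl eta eta' xi i j (s : R) : j = i.+1 :> nat ->
    (forall l, (eta' l)%:R = (eta l)%:R + s * ((l == j)%:R - (l == i)%:R)) ->
  dual_exponent eta' xi = dual_exponent eta xi + s * ((xi i)%:R + (xi j)%:R).
Proof.
move=> ij eta'E.
have -> : (xi i)%:R + (xi j)%:R =
    \sum_l (xi l)%:R * (l == i)%:R + \sum_l (xi l)%:R * (l == j)%:R :> R.
  by rewrite !sum_mulr_natr_eq.
rewrite -big_split/= mulr_sumr /dual_exponent -big_split/=; apply: eq_bigr => l _.
under eq_bigr do rewrite eta'E.
rewrite eta'E big_split/= -mulr_sumr sumrB !sum_natr_eq -mulrDr -!val_eqE/= ij.
have [li|li|->] := ltngtP l i.
- rewrite (ltn_trans li (ltnSn _)) (@ltn_eqF l i.+1) ?(ltn_trans li) //=; ring.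
- by rewrite ltnS leqNgt li/=; case: (l == i.+1 :> nat) => /=; ring.
- rewrite ltnSn (@ltn_eqF i i.+1)//=; ring.
Qed.

(** The coefficient of xi_l drops by eta_i + eta_j + 4k from [i] to [j]; 4k is written
    [2 * k + 2 * k] to match the factor [K * K] of [two_site_identity]. *)
Lemma dual_exponent_hopr eta xi xi' i j (s : R) : j = i.+1 :> nat ->
    (forall l, (xi' l)%:R = (xi l)%:R + s * ((l == j)%:R - (l == i)%:R)) ->
  dual_exponent eta xi' =
  dual_exponent eta xi - s * ((eta i)%:R + (eta j)%:R + (2 * k + 2 * k)).
Proof.
move=> ij xi'E; rewrite /dual_exponent; under eq_bigr do rewrite xi'E mulrDl.
rewrite big_split/=; congr (_ + _).
set F := fun l => (eta l)%:R + 2 * \sum_(m < L | (l < m)%N) (eta m)%:R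
  - 4 * k * l.+1%:R : R.
transitivity (s * (\sum_l F l * (l == j)%:R - \sum_l F l * (l == i)%:R)).
  by rewrite -sumrB mulr_sumr; apply: eq_bigr => l _; rewrite /F; ring.
(* The particles to the right of [i] are those at [j] and those to the right of [j]. *)
rewrite !sum_mulr_natr_eq /F [in X in s * (_ - X)](bigD1 j)/=; last by rewrite ij.
rewrite [X in _ - (_ + 2 * (_ + X) - _)](eq_bigl (fun m : 'I_L => (j < m)%N));
  last first.
  by move=> m /=; rewrite -val_eqE/= ij; lia.
by rewrite ij -!natr1; ring.
Qed.

Definition off_bond i j eta xi :=
  \prod_(l | (l != i) && (l != j)) w (eta l) (xi l).

Lemma off_bondC i j eta xi : off_bond i j eta xi = off_bond j i eta xi.
Proof. by apply: eq_bigl => l; rewrite andbC. Qed.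

Lemma dual_split i j eta xi : i != j ->
  dual_kernel eta xi = w (eta i) (xi i) * w (eta j) (xi j) *
    (off_bond i j eta xi * q `^ dual_exponent eta xi).
Proof.
move=> ij; rewrite /dual_kernel (bigD1 i)//= (bigD1 j) 1?eq_sym//=.
by rewrite /off_bond -!mulrA.
Qed.

(** From an empty site, [hop] would create a particle. The factor [qnum q (eta i)%:R] makes both
    sides 0 then, so the exponent is needed only for true jumps. *)
Lemma dual_hopl i j eta xi d : i != j ->
    ((0 < eta i)%N -> dual_exponent (hop eta i j) xi = dual_exponent eta xi + d) ->
  qnum q (eta i)%:R * dual_kernel (hop eta i j) xi =
  qnum q (eta i)%:R * w (eta i).-1 (xi i) * w (eta j).+1 (xi j) *
    (off_bond i j eta xi * q `^ dual_exponent eta xi) * q `^ d.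
Proof.
move=> ij dE; have [->|i0] := posnP (eta i); first by rewrite qnum0 !mul0r.
rewrite (dual_split _ _ ij) dE// powR_baseD// hop_src// hop_dst// -!mulrA.
suff -> : off_bond i j (hop eta i j) xi = off_bond i j eta xi by [].
by apply: eq_bigr => l /andP[li lj]; rewrite hop_off.
Qed.

Lemma dual_hopr i j eta xi d : i != j ->
    ((0 < xi i)%N -> dual_exponent eta (hop xi i j) = dual_exponent eta xi + d) ->
  qnum q (xi i)%:R * dual_kernel eta (hop xi i j) =
  qnum q (xi i)%:R * w (eta i) (xi i).-1 * w (eta j) (xi j).+1 *
    (off_bond i j eta xi * q `^ dual_exponent eta xi) * q `^ d.
Proof.
move=> ij dE; have [->|i0] := posnP (xi i); first by rewrite qnum0 !mul0r.
rewrite (dual_split _ _ ij) dE// powR_baseD// hop_src// hop_dst// -!mulrA.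
suff -> : off_bond i j eta (hop xi i j) = off_bond i j eta xi by [].
by apply: eq_bigr => l /andP[li lj]; rewrite hop_off.
Qed.

Lemma bond_duality i j eta xi : j = i.+1 :> nat ->
  asip_bond q k i j (dual_kernel^~ xi) eta =
  asip_bond q k i j (dual_kernel eta) xi.
Proof.
move=> ij.
have Dij : i != j by rewrite -val_eqE/= ij (@ltn_eqF i i.+1).
have Dji : j != i by rewrite eq_sym.
have hopE (ze : config L) i' j' l : (0 < ze i')%N ->
    (hop ze i' j' l)%:R = (ze l)%:R + 1 * ((l == j')%:R - (l == i')%:R) :> R.
  by move=> i0; rewrite natr_hop// mul1r.
have hopNE (ze : config L) i' j' l : (0 < ze i')%N ->
    (hop ze i' j' l)%:R = (ze l)%:R + -1 * ((l == i')%:R - (l == j')%:R) :> R.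
  by move=> i0; rewrite natr_hop//; ring.
have H1 := dual_hopl Dij
  (fun h => dual_exponent_hopl xi ij (fun l => hopE eta i j l h)).
have H2 := dual_hopl Dji
  (fun h => dual_exponent_hopl xi ij (fun l => hopNE eta j i l h)).
have H3 := dual_hopr Dij
  (fun h => dual_exponent_hopr eta ij (fun l => hopE xi i j l h)).
have H4 := dual_hopr Dji
  (fun h => dual_exponent_hopr eta ij (fun l => hopNE xi j i l h)).
have H0 := dual_split eta xi Dij.
rewrite (off_bondC j i) in H2; rewrite (off_bondC j i) in H4.
(* The weights away from the bond and the power of q before the jump are common to all terms; they
   become [M]. *)
move: (off_bond i j eta xi * q `^ dual_exponent eta xi) H0 H1 H2 H3 H4 => M H0 H1 H2 H3 H4.
have [u [U1 U2 U3 U4 U5]] := weight_neighbours q01 k_gt0 (eta i) (xi i).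
have [v [V1 V2 V3 V4 V5]] := weight_neighbours q01 k_gt0 (eta j) (xi j).
rewrite /asip_bond.
set G1 := dual_kernel (hop eta i j) xi in H1 *; set G2 := dual_kernel (hop eta j i) xi in H2 *.
set G3 := dual_kernel eta (hop xi i j) in H3 *; set G4 := dual_kernel eta (hop xi j i) in H4 *.
set a := (eta i)%:R in H1 H2 H3 H4 U1 U2 U3 U4 U5 *.
set b := (eta j)%:R in H1 H2 H3 H4 V1 V2 V3 V4 V5 *.
set x := (xi i)%:R in H1 H2 H3 H4 U1 U2 U3 U4 U5 *.
set y := (xi j)%:R in H1 H2 H3 H4 V1 V2 V3 V4 V5 *.
rewrite U5 V4 in H1; rewrite V5 U4 in H2; rewrite U1 V1 in H0.
(* Here and in [H4'], the rate factor [2k + y] or [2k + x] cancels the last denominator of the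
   weight at the receiving site. *)
have H3' : qnum q x * qnum q (2 * k + y) * G3 =
    qnum q x * qnum q (2 * k + x - 1) * u *
    (v * qnum q (b - y + 1) * qnum q (b - y)) * M
    * q `^ (- (1 * (a + b + (2 * k + 2 * k)))).
  by rewrite mulrAC H3 U3 -V2; ring.
have H4' : qnum q (2 * k + x) * qnum q y * G4 =
    qnum q y * qnum q (2 * k + y - 1) * v *
    (u * qnum q (a - x + 1) * qnum q (a - x)) * M
    * q `^ (- (-1 * (a + b + (2 * k + 2 * k)))).
  by rewrite -mulrA H4 V3 -U2; ring.
transitivity (
  q `^ (a - b + (2 * k - 1)) * qnum q (2 * k + b)
    * (qnum q a * G1 - qnum q a * dual_kernel eta xi)
  + q `^ (a - b - (2 * k - 1)) * qnum q (2 * k + a)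
    * (qnum q b * G2 - qnum q b * dual_kernel eta xi)); first by ring.
transitivity (
  q `^ (x - y + (2 * k - 1)) * (qnum q x * qnum q (2 * k + y) * G3
      - qnum q x * qnum q (2 * k + y) * dual_kernel eta xi)
  + q `^ (x - y - (2 * k - 1)) * (qnum q (2 * k + x) * qnum q y * G4
      - qnum q (2 * k + x) * qnum q y * dual_kernel eta xi)); last by ring.
rewrite H1 H2 H3' H4' H0 {H1 H2 H3 H4 H3' H4' H0 U1 U2 U3 U4 U5 V1 V2 V3 V4 V5}.
rewrite mulN1r opprK !mul1r mulN1r !qnumE.
have qB := powR_baseB q01; have qD := powR_baseD q01; have q0 := powR_base_neq0 q01.
have q1 : q `^ 1 = q by rewrite powRr1// ltW; case/andP: q01.
rewrite !powRN !(qB, qD) !q1.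
have := two_site_identity (Q := q) (A := q `^ a) (B := q `^ b) (X := q `^ x)
  (Y := q `^ y) (K := q `^ (2 * k)).
rewrite !q0 qsq_neq1// -[in q != 0]q1 q0 => /(_ isT isT isT isT isT isT isT) /=.
(* The two-site identity lacks only the common factor [u * v * M]. *)
move=> /(congr1 (fun z => z * (u * v * M))) H.
by apply: eq_trans (eq_trans H _); rewrite !invfM ?invrK; ring.
Qed.

Lemma generator_duality eta xi :
  asip_generator q k (dual_kernel^~ xi) eta =
  asip_generator q k (dual_kernel eta) xi.
Proof.
apply: eq_bigr => i _; apply: eq_bigr => j /eqP ij.
exact: bond_duality.
Qed.

(** * The two duality functions in terms of the kernel *)

Lemma qfact_neq0 n : qfact q n != 0.
Proof.
rewrite /qfact big_add1 big_mkord; apply/prodf_neq0 => i _.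
by rewrite qnum_neq0.
Qed.

Lemma qfactS n : qfact q n.+1 = qfact q n * qnum q n.+1%:R.
Proof. by rewrite /qfact !big_add1/= big_nat_recr. Qed.

Lemma qfall_gt a x : (a < x)%N -> qfall q a x = 0.
Proof.
move=> ax; rewrite /qfall (bigD1 (Ordinal ax))//=.
by rewrite subrr qnum0 mul0r.
Qed.

Lemma qfact_qfall a x : (x <= a)%N ->
  qfact q a = qfall q a x * qfact q (a - x).
Proof.
elim: x => [|x IH] xa; first by rewrite /qfall big_ord0 mul1r subn0.
rewrite IH 1?ltnW// -(@subnSK x a)// qfactS qfallSr// mulrA mulrAC.
by rewrite subnSK// natrB 1?ltnW.
Qed.

Lemma qbinom2kE x : qbinom2k q k x = qrise q k x / qfact q x.
Proof.
rewrite /qbinom2k big_split/= prodfV /qfact /qrise big_add1 big_mkord.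
congr (_ / _); apply: eq_bigr => j _; congr qnum.
by rewrite -natr1; lra.
Qed.

(** Both coefficients carry the denominator [x]!, which cancels in the quotient and leaves [qfall]
    over [qrise]; for [x > a] both sides are 0. *)
Lemma qbinom_weight a x :
  qbinom q a x / qbinom2k q k x * ((x <= a)%N)%:R = w a x.
Proof.
rewrite /weight; case: leqP => [xa|ax]; last first.
  by rewrite qfall_gt// mulr0 mul0r.
rewrite mulr1 /qbinom qbinom2kE (qfact_qfall xa).
field; rewrite qrise_neq0// !qfact_neq0//.
Qed.

(** Turns a factor of a q^2-Pochhammer symbol into a q-number; the constant q^-1 - q cancels in
    quotients of symbols of equal length. *)
Lemma one_sub_powR x : 1 - q `^ (2 * x) = q `^ x * (q^-1 - q) * qnum q x.
Proof.
rewrite qnumE (_ : 2 * x = x + x) ?powR_baseD//; last by ring.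
have q1 := qsq_neq1 q01; have qx := powR_base_neq0 q01 x.
have q0 : q != 0 by rewrite lt0r_neq0//; case/andP: q01.
by field; rewrite q0 q1 qx.
Qed.

Lemma qpochE x n : qpoch (q `^ (2 * x)) (q ^+ 2) n =
  \prod_(j < n) q `^ (x + j%:R) * \prod_(j < n) (q^-1 - q) *
  \prod_(j < n) qnum q (x + j%:R).
Proof.
rewrite -2!big_split/= /qpoch big_mkord; apply: eq_bigr => j _.
rewrite -one_sub_powR// mulrDr powR_baseD//; congr (1 - _ * _).
by rewrite powRrM !powR_mulrn ?exprn_ge0 ?ltW//; case/andP: q01.
Qed.

Lemma qpoch_weight a x :
  qpoch (q `^ (2 * (a%:R - x%:R + 1))) (q ^+ 2) x /
    qpoch (q `^ (4 * k)) (q ^+ 2) x * ((x <= a)%N)%:R =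
  w a x * q `^ ((a%:R - x%:R + 1 - 2 * k) * x%:R).
Proof.
rewrite /weight; case: leqP => [xa|ax]; last first.
  by rewrite qfall_gt// mulr0 !mul0r.
rewrite mulr1 (_ : 4 * k = 2 * (2 * k)); last by ring.
rewrite !qpochE.
(* The Pochhammer symbol runs upwards from [a - x + 1] to [a], the reverse of [qfall]. *)
have -> : qfall q a x = \prod_(j < x) qnum q (a%:R - x%:R + 1 + j%:R).
  rewrite /qfall (reindex_inj rev_ord_inj)/=; apply: eq_bigr => j _.
  by rewrite natrB// -natr1; congr qnum; lra.
(* The exponents of numerator and denominator differ by a - x + 1 - 2k for each of the [x]
   factors. *)
have -> : \prod_(j < x) q `^ (a%:R - x%:R + 1 + j%:R) =
    \prod_(j < x) q `^ (2 * k + j%:R) * q `^ ((a%:R - x%:R + 1 - 2 * k) * x%:R).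
  rewrite -!powR_base_sum// -powR_baseD//; congr (_ `^ _).
  have -> : (a%:R - x%:R + 1 - 2 * k) * x%:R =
      \sum_(j < x) (a%:R - x%:R + 1 - 2 * k).
    by rewrite sumr_const card_ord mulr_natr.
  by rewrite -big_split/=; apply: eq_bigr => j _; ring.
have p0 : \prod_(j < x) q `^ (2 * k + j%:R) != 0.
  by apply/prodf_neq0 => j _; exact: powR_base_neq0.
have c0 : \prod_(j < x) (q^-1 - q) != 0 :> R.
  apply/prodf_neq0 => j _; have := qsq_neq1 q01; apply: contra_neq => qV.
  have q0 : q != 0 by rewrite lt0r_neq0//; case/andP: q01.
  by have -> : q * q - 1 = - q * (q^-1 - q); [field|rewrite qV mulr0].
have r0 := qrise_neq0 q01 k_gt0 x; rewrite /qrise in r0 *.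
by field; rewrite p0 c0 r0.
Qed.

Lemma exchange_sum_lt (F : 'I_L -> 'I_L -> R) :
  \sum_(i < L) \sum_(m < L | (m < i)%N) F i m =
  \sum_(m < L) \sum_(i < L | (m < i)%N) F i m.
Proof. by rewrite (exchange_big_dep predT). Qed.

(** Off the diagonal, the pairs m < i and m > i contribute equally. This turns the terms quadratic
    in xi in the exponent of [asip_D] into the squared particle number. *)
Lemma sum_sqr_lt (f : 'I_L -> R) :
  \sum_i f i * (2 * (\sum_(m < L | (m < i)%N) f m) + f i) = (\sum_i f i) ^+ 2.
Proof.
rewrite expr2 mulr_suml.
have split i : f i * (\sum_j f j) = f i * (\sum_(m < L | (m < i)%N) f m)
    + f i * (\sum_(m < L | (i < m)%N) f m) + f i * f i.
  rewrite -!mulrDr (bigD1 i)//= (bigID (fun m : 'I_L => (m < i)%N))/= addrC.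
  congr (_ * (_ + _ + _)); apply: eq_bigl => m; rewrite -val_eqE/=; lia.
under [RHS]eq_bigr do rewrite split.
rewrite 2!big_split/=.
have -> : \sum_i f i * (\sum_(m < L | (i < m)%N) f m) =
    \sum_i f i * (\sum_(m < L | (m < i)%N) f m).
  under eq_bigr do rewrite mulr_sumr.
  under [RHS]eq_bigr do rewrite mulr_sumr.
  rewrite exchange_sum_lt; apply: eq_bigr => i _.
  by apply: eq_bigr => j _; exact: mulrC.
by rewrite -!big_split/=; apply: eq_bigr => i _; ring.
Qed.

Lemma asip_D_dual eta xi :
  asip_D q k eta xi = q `^ (- (\sum_i (xi i)%:R) ^+ 2) * dual_kernel eta xi.
Proof.
rewrite /asip_D; under eq_bigr => i _ do rewrite mulrAC qbinom_weight.
rewrite big_split/= -powR_base_sum// mulrCA -powR_baseD//.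
congr (_ * _ `^ _); rewrite -sum_sqr_lt /dual_exponent -sumrN.
have -> : \sum_(i < L) ((((eta i)%:R - (xi i)%:R)
     * (2 * \sum_(m < L | (m < i)%N) (xi m)%:R + (xi i)%:R)
     - 4 * k * i.+1%:R * (xi i)%:R)) =
   \sum_(i < L) (- ((xi i)%:R * (2 * (\sum_(m < L | (m < i)%N) (xi m)%:R) + (xi i)%:R)))
   + (\sum_(i < L) (xi i)%:R * ((eta i)%:R - 4 * k * i.+1%:R)
   + 2 * \sum_(i < L) \sum_(m < L | (m < i)%N) (eta i)%:R * (xi m)%:R) :> R.
  rewrite mulr_sumr -!big_split/=; apply: eq_bigr => i _.
  by rewrite -mulr_sumr; ring.
(* Exchanging the sums collects, for each xi_m, the particles of eta to the right of m. *)
rewrite exchange_sum_lt mulr_sumr -big_split/=; congr (_ + _).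
by apply: eq_bigr => i _; rewrite -mulr_suml; ring.
Qed.

(** The squares of xi_i cancel site by site; beside the exponent of the kernel only a multiple of
    the particle number remains. *)
Lemma asip_D'_dual eta xi :
  asip_D' q k eta xi = q `^ ((1 - 2 * k) * \sum_i (xi i)%:R) * dual_kernel eta xi.
Proof.
rewrite /asip_D'; under eq_bigr => i _.
  rewrite mulrAC qpoch_weight -(mulrA (w _ _)).
  rewrite -powR_baseD//; over.
rewrite big_split/= -powR_base_sum// mulrCA -powR_baseD//.
congr (_ * _ `^ _); rewrite mulr_sumr -big_split/=; apply: eq_bigr => i _.
by rewrite /num_right natr_sum; ring.
Qed.

End Duality.

(** * From generators to expectations *)

(** Lets finitely many states share one step size, which makes the o(h) errors uniform. *)
Lemma near_all_mem {T : Type} {F : set_system T} {FF : Filter F}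
    (I : eqType) (l : seq I) (Q : I -> T -> Prop) :
  (forall i, i \in l -> \forall h \near F, Q i h) ->
  \forall h \near F, forall i, i \in l -> Q i h.
Proof.
elim: l => [|i l IH] Ql; first by apply: nearW.
have Hi := Ql i (mem_head _ _).
have Hl := IH (fun i' il => Ql i' (mem_behead (s := i :: l) il)).
near=> h => i'; rewrite inE => /predU1P[->|i'l]; first by near: h.
by move: i' i'l; near: h.
Unshelve. all: by end_near. Qed.

Lemma near0_subdivision {R : realType} (t : R) (Q : R -> Prop) : 0 < t ->
  (\forall h \near 0^'+, Q h) -> exists n : nat, Q (t / n.+1%:R).
Proof.
(* By the Archimedean bound [n > t / e], hence [t / n.+1%:R < e]. *)
move=> t0 [e /= e0 Qe]; exists (Num.bound (t / e)).
have n0 : 0 < (Num.bound (t / e)).+1%:R :> R by [].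
apply: Qe; last by rewrite divr_gt0.
rewrite /= sub0r normrN gtr0_norm ?divr_gt0// ltr_pdivrMr// mulrC.
rewrite -ltr_pdivrMr// (lt_trans (archi_boundP _)) ?divr_ge0 ?ltW//.
by rewrite ltr_nat.
Qed.

(** * Transition probabilities and finite invariant sets *)

Section Transition.
Context {R : realType} {S : countType} {gen : (S -> R) -> S -> R}
  {d : measure_display} {T : measurableType d}
  {P : S -> probability T R} {X : R -> T -> S}.
Hypothesis XP : markov_jump_process gen P X.
Implicit Types (l : seq S) (x y z : S) (g : S -> R) (s t : R).

Definition transition t x y : R := fine (P x (X t @^-1` [set y])).

Lemma transition_ge0 t x y : 0 <= transition t x y.
Proof. by rewrite fine_ge0. Qed.

Lemma transition0 x y : transition 0 x y = (y == x)%:R.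
Proof.
rewrite /transition; have [->|yx] := eqVneq y x; first by rewrite (mjp_start XP).
rewrite (subset_measure0 (B := ~` (X 0 @^-1` [set x])))//.
- exact: (mjp_measurable XP).
- by apply: measurableC; exact: (mjp_measurable XP).
- by move=> w /= -> /eqP; rewrite (negPf yx).
- have mX := mjp_measurable XP x (lexx 0).
  apply: eq_trans (probability_setC (P x) mX) _.
  by rewrite (mjp_start XP) subee.
Qed.

Lemma transitionE t x y : 0 <= t ->
  (transition t x y)%:E = P x (X t @^-1` [set y]).
Proof.
by move=> t0; rewrite fineK// fin_num_measure//; exact: (mjp_measurable XP).
Qed.

Lemma measurable_mem t l : 0 <= t -> measurable [set w | X t w \in l].
Proof.
move=> t0; elim: l => [|y l IH].
  by rewrite (_ : [set w | _] = set0)//; apply/seteqP; split.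
rewrite (_ : [set w | _] = X t @^-1` [set y] `|` [set w | X t w \in l]).
  by apply: measurableU => //; exact: (mjp_measurable XP).
apply/seteqP; split=> w /=; rewrite inE; first by move/predU1P.
by move=> H; apply/predU1P.
Qed.

Lemma measure_mem x t l (A : set T) : 0 <= t -> uniq l -> measurable A ->
  P x (A `&` [set w | X t w \in l]) =
  (\sum_(y <- l) P x (A `&` X t @^-1` [set y]))%E.
Proof.
move=> t0 ul mA; elim: l ul => [_|y l IH /= /andP[yl ul]].
  rewrite big_nil (_ : _ `&` _ = set0) ?measure0//.
  by apply/seteqP; split=> w //= [].
rewrite big_cons -IH// -measureU.
- congr (P x _); apply/seteqP; split=> w /=; rewrite inE.
    by move=> [Aw /predU1P[]]; [left|right].
  by move=> [[Aw /= wy]|[Aw /= wl]]; rewrite ?wy ?wl ?eqxx ?orbT.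
- by apply: measurableI => //; exact: (mjp_measurable XP).
- by apply: measurableI => //; exact: measurable_mem.
- apply/seteqP; split=> w //= [[_ wy] [_ wl]].
  by rewrite -wy wl in yl.
Qed.

Lemma sum_transitionE x t l : 0 <= t -> uniq l ->
  (\sum_(y <- l) transition t x y)%:E = P x [set w | X t w \in l].
Proof.
move=> t0 ul; rewrite -sumEFin -[X in P x X]setTI measure_mem//.
by apply: eq_bigr => y _; rewrite setTI transitionE.
Qed.

Lemma sum_transition_le1 x t l : 0 <= t -> uniq l ->
  \sum_(y <- l) transition t x y <= 1.
Proof.
by move=> t0 ul; rewrite -lee_fin sum_transitionE// probability_le1//;
  exact: measurable_mem.
Qed.

Lemma expectation_on x t l g : 0 <= t -> uniq l ->
  ('E_(P x)[(fun w => (X t w \in l)%:R * g (X t w))%R])%E =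
  (\sum_(y <- l) transition t x y * g y)%:E.
Proof.
move=> t0 ul; rewrite unlock.
have mX y := mjp_measurable XP y t0.
rewrite (eq_integral
  (fun w => (\sum_(y <- l) (g y)%:E * (\1_(X t @^-1` [set y]) w)%:E)%E)).
  rewrite integral_sum//; last first.
    by move=> y; apply: integrableZl => //; exact: integrable_indic.
  rewrite -sumEFin; apply: eq_bigr => y _.
  rewrite integralZl//; last exact: integrable_indic.
  by rewrite integral_indic// setIT EFinM muleC transitionE.
move=> w _; under [RHS]eq_bigr do rewrite -EFinM.
rewrite sumEFin; congr (_%:E).
have H y : \1_(X t @^-1` [set y]) w = (y == X t w)%:R :> R.
  by rewrite indicE eq_sym; case: eqP => wy; [rewrite mem_set|rewrite memNset].
have [wl|wl] := boolP (X t w \in l); last first.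
  rewrite mul0r big_seq big1// => y yl; rewrite H.
  by case: eqP yl => [->|_]; rewrite ?(negPf wl)// mulr0.
rewrite mul1r (bigD1_seq (X t w))//= H eqxx mulr1 big1 ?addr0// => y yX.
by rewrite H (negPf yX) mulr0.
Qed.

(** Only the paths that are in [l] at time [s] are counted, hence an inequality; the Markov property
    is used with the trivial past event. *)
Lemma transition_add_ge x z s t l : 0 <= s -> 0 <= t -> uniq l ->
  \sum_(y <- l) transition s x y * transition t y z <= transition (s + t) x z.
Proof.
move=> s0 t0 ul; have st0 : 0 <= s + t by rewrite addr_ge0.
have mz := mjp_measurable XP z st0.
rewrite -lee_fin transitionE// -sumEFin.
rewrite (_ : (\sum_(y <- l) _)%E =
    P x (X (s + t) @^-1` [set z] `&` [set w | X s w \in l])).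
  by apply: le_measure; rewrite ?inE//; apply: measurableI => //;
    exact: measurable_mem.
rewrite measure_mem//; apply: eq_bigr => y _.
have := mjp_markov XP x y z s0 t0 (A := setT).
rewrite setTI setIC EFinM !transitionE// => ->//.
rewrite -setC0; apply: sigma_algebraC; exact: sigma_algebra0.
Qed.

(** Cutting [g] off outside the finite list makes it bounded, as [mjp_generator] demands; the limit
    is then multiplied by [h]. *)
Lemma transition_generator l g x (e : R) : uniq l -> x \in l -> 0 < e ->
  \forall h \near 0^'+,
    `|\sum_(y <- l) transition h x y * g y - g x
      - h * gen (fun y => (y \in l)%:R * g y) x| <= e * h.
Proof.
move=> ul xl e0; pose f y := (y \in l)%:R * g y.
have fM : exists M : R, forall y, `|f y| <= M.
  exists (\sum_(y <- l) `|g y|) => y; rewrite /f.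
  have [yl|yl] := boolP (y \in l); last first.
    by rewrite mul0r normr0 sumr_ge0.
  by rewrite mul1r (bigD1_seq y)//= lerDl sumr_ge0.
have /cvgrPdist_le/(_ _ e0) := mjp_generator XP (x := x) fM.
apply: filterS2 (nbhs_right_gt 0) => h h0.
rewrite /comp (expectation_on _ _ (ltW h0))//= /f/= xl mul1r -/f => H.
have -> : forall a b : R, a - h * b = - (h * (b - a / h)).
  by move=> a b; field; rewrite gt_eqF.
by rewrite normrN normrM gtr0_norm// mulrC ler_pM2r.
Qed.

Section Invariant.
Variable l : seq S.
Hypotheses (l_uniq : uniq l)
  (l_inv : forall x, x \in l -> gen (fun y => (y \in l)%:R) x = 0).

Lemma sum_transition x t : x \in l -> 0 <= t ->
  \sum_(y <- l) transition t x y = 1.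
Proof.
rewrite le_eqVlt => xl /predU1P[<-|t0].
  under eq_bigr do rewrite transition0.
  rewrite (bigD1_seq x)//= eqxx big1 ?addr0// => y /negPf ->.
  by [].
apply/eqP; rewrite eq_le (sum_transition_le1 _ (ltW t0))//=.
apply/ler_addgt0Pl => e e0; rewrite -lerBlDl.
(* With loss rate [e / t], the mass lost over the whole time [t] is at most [e]. *)
have et0 : 0 < e / t by rewrite divr_gt0.
have small : \forall h \near 0^'+, forall x, x \in l ->
    1 - e / t * h <= \sum_(y <- l) transition h x y.
  apply: near_all_mem => y yl.
  apply: filterS (transition_generator (fun=> 1) l_uniq yl et0) => h.
  under eq_bigr do rewrite mulr1.
  rewrite (_ : (fun y => _) = (fun y => (y \in l)%:R)); last first.
    by apply/funext => ?; rewrite mulr1.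
  by rewrite l_inv// mulr0 subr0 ler_distl => /andP[].
have [n [h0 Hh]] := near0_subdivision t0 (filterI (nbhs_right_gt 0) small).
set h := t / n.+1%:R in h0 Hh.
have mass m y : y \in l -> 1 - m.+1%:R * (e / t * h) <=
    \sum_(z <- l) transition (m.+1%:R * h) y z.
  elim: m y => [|m IH] y yl; first by rewrite !mul1r Hh.
  have mh0 : 0 <= m.+1%:R * h by rewrite mulr_ge0// ltW.
  rewrite -natr1 !mulrDl !mul1r.
  apply: (@le_trans _ _ (\sum_(w <- l) transition (m.+1%:R * h) y w *
      \sum_(z <- l) transition h w z)); last first.
    under eq_bigr do rewrite mulr_sumr.
    rewrite exchange_big/=; apply: ler_sum => z _.
    by apply: transition_add_ge => //; exact: ltW.
  (* From each state of [l] one more step loses at most [e / t * h]; weighted by a mass of at most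
     1, the losses just add up. *)
  apply: (@le_trans _ _ (\sum_(w <- l) transition (m.+1%:R * h) y w *
      (1 - e / t * h))); last first.
    rewrite big_seq [leRHS]big_seq; apply: ler_sum => w wl.
    by rewrite ler_wpM2l ?transition_ge0// Hh.
  rewrite -mulr_suml mulrBr mulr1 opprD addrA lerB ?IH//.
  by rewrite ler_piMl ?sum_transition_le1//; apply: mulr_ge0; exact: ltW.
have := mass n x xl.
have tE : n.+1%:R * h = t by rewrite /h mulrC divfK.
by rewrite mulrCA tE divfK ?gt_eqF.
Qed.

(** The inequality [transition_add_ge] holds for every end state, and both sides have total mass 1
    over [l]; hence each difference is 0. *)
Lemma transition_add x z s t : x \in l -> z \in l -> 0 <= s -> 0 <= t ->
  transition (s + t) x z =
  \sum_(y <- l) transition s x y * transition t y z.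
Proof.
move=> xl zl s0 t0; apply/eqP; rewrite eq_le [X in _ && X]transition_add_ge//.
set r := fun z => \sum_(y <- l) transition s x y * transition t y z.
rewrite -/(r z); have rle w : r w <= transition (s + t) x w.
  exact: transition_add_ge.
have : \sum_(z <- l) (transition (s + t) x z - r z) = 0.
  rewrite sumrB sum_transition ?addr_ge0// exchange_big/=.
  under eq_bigr do rewrite -mulr_sumr.
  rewrite big_seq.
  under eq_bigr => y yl do rewrite sum_transition// mulr1.
  by rewrite -big_seq sum_transition// subrr.
rewrite (bigD1_seq z)//= => /eqP; rewrite paddr_eq0 ?subr_ge0//; last first.
  by apply: sumr_ge0 => y _; rewrite subr_ge0.
by case/andP; rewrite subr_eq0 => /eqP -> _; rewrite lexx.
Qed.

(** Almost surely [X t] lies in [l], so [g (X t)] agrees a.e. with its cut-off, for arbitrary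
    [g]. *)
Lemma expectation_invariant x t g : x \in l -> 0 <= t ->
  ('E_(P x)[(fun w => g (X t w))%R] =
   (\sum_(y <- l) transition t x y * g y)%:E)%E.
Proof.
move=> xl t0; rewrite -expectation_on// unlock.
have mX (f : S -> R) : measurable_fun setT (EFin \o (f \o X t : T -> R)).
  apply/measurable_EFinP.
  move=> _ Y mY; rewrite setTI.
  (* Since [S] is countable, any preimage is a countable union of events [X t = y]. *)
  rewrite (_ : _ @^-1` _ =
      \bigcup_(y in [set y | Y (f y)]) X t @^-1` [set y]).
    rewrite bigcup_mkcond; apply: countable_bigcupT_measurable => //.
    by move=> y; case: ifP => // _; exact: (mjp_measurable XP).
  apply/seteqP; split=> w /=; first by move=> Yw; exists (X t w).
  by move=> [y Yy wy]; rewrite wy.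
apply: ae_eq_integral => //; [exact: mX | exact: (mX (fun y => (y \in l)%:R * g y))|].
exists (~` [set w | X t w \in l]); split.
- by apply: measurableC; exact: measurable_mem.
- apply: eq_trans (probability_setC (P x) (measurable_mem l t0)) _.
  by rewrite -sum_transitionE// sum_transition// subee.
- move=> w /=; apply: contra_not => wl _.
  by rewrite wl mul1r.
Qed.

End Invariant.
End Transition.

(** * Duality of processes from duality of generators *)

Section AbstractDuality.
Context {R : realType} {S1 S2 : countType}
  {gen1 : (S1 -> R) -> S1 -> R} {gen2 : (S2 -> R) -> S2 -> R}
  {d1 d2 : measure_display}
  {T1 : measurableType d1} {T2 : measurableType d2}
  {P1 : S1 -> probability T1 R} {X1 : R -> T1 -> S1}
  {P2 : S2 -> probability T2 R} {X2 : R -> T2 -> S2}.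
Hypotheses (X1P : markov_jump_process gen1 P1 X1)
  (X2P : markov_jump_process gen2 P2 X2).
Variables (l1 : seq S1) (l2 : seq S2) (D : S1 -> S2 -> R).
Hypotheses (l1_uniq : uniq l1) (l2_uniq : uniq l2)
  (l1_inv : forall x, x \in l1 -> gen1 (fun y => (y \in l1)%:R) x = 0)
  (l2_inv : forall z, z \in l2 -> gen2 (fun w => (w \in l2)%:R) z = 0)
  (gen_duality : forall x z, x \in l1 -> z \in l2 ->
    gen1 (fun y => (y \in l1)%:R * D y z) x =
    gen2 (fun w => (w \in l2)%:R * D x w) z).

Let p1 := @transition R S1 d1 T1 P1 X1.
Let p2 := @transition R S2 d2 T2 P2 X2.

(* The joint expectation E_(x,z)[D(X1_s, X2_r)] for independent processes. *)
Let joint s r x z := \sum_(y <- l1) \sum_(w <- l2) p1 s x y * p2 r z w * D y w.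

(** Chapman-Kolmogorov at time [s] isolates the last step [h], so the short-time expansion acts on
    [D] itself. *)
Let joint_addl s h r x z : x \in l1 -> 0 <= s -> 0 <= h ->
  joint (s + h) r x z = \sum_(y <- l1) \sum_(w <- l2)
    p1 s x y * p2 r z w * \sum_(y' <- l1) p1 h y y' * D y' w.
Proof.
move=> xl s0 h0; rewrite /joint big_seq.
under eq_bigr => y yl.
  under eq_bigr do rewrite /p1 (transition_add X1P l1_uniq l1_inv)// !mulr_suml.
  rewrite exchange_big/=; over.
rewrite -big_seq exchange_big/=; apply: eq_bigr => y _.
rewrite exchange_big/=; apply: eq_bigr => w _.
by rewrite mulr_sumr; apply: eq_bigr => y' _; rewrite /p1; ring.
Qed.

Let joint_addr s h r x z : z \in l2 -> 0 <= r -> 0 <= h ->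
  joint s (r + h) x z = \sum_(y <- l1) \sum_(w <- l2)
    p1 s x y * p2 r z w * \sum_(w' <- l2) p2 h w w' * D y w'.
Proof.
move=> zl s0 h0; apply: eq_bigr => y _; rewrite big_seq.
under eq_bigr => w wl.
  rewrite /p2 (transition_add X2P l2_uniq l2_inv)// mulr_sumr mulr_suml; over.
rewrite -big_seq exchange_big/=; apply: eq_bigr => w _.
by rewrite mulr_sumr; apply: eq_bigr => w' _; rewrite /p2; ring.
Qed.

Lemma transition_duality x z t : x \in l1 -> z \in l2 -> 0 < t ->
  \sum_(y <- l1) p1 t x y * D y z = \sum_(w <- l2) p2 t z w * D x w.
Proof.
move=> xl zl t0.
suff : joint t 0 x z = joint 0 t x z.
  rewrite /joint => jE.
  under eq_bigr => y _.
    rewrite (_ : _ * _ = \sum_(w <- l2) p1 t x y * p2 0 z w * D y w).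
      over.
    rewrite (bigD1_seq z)//= /p2 (transition0 X2P) eqxx mulr1 big1 ?addr0//.
    by move=> w /negPf wz; rewrite (transition0 X2P) wz mulr0 mul0r.
  rewrite jE (bigD1_seq x)//= [X in _ + X]big1 ?addr0; last first.
    move=> y /negPf yx; rewrite big1// => w _.
    by rewrite /p1 (transition0 X1P) yx !mul0r.
  by apply: eq_bigr => w _; rewrite /p1 (transition0 X1P) eqxx mul1r.
apply/eqP; rewrite -subr_eq0 -normr_le0; apply/ler_addgt0Pl => e e0.
(* Half of [e / t], because each of the two processes contributes one error. *)
rewrite addr0; pose c := e / t / 2.
have c0 : 0 < c by rewrite !divr_gt0.
have small1 : \forall h \near 0^'+, forall y, y \in l1 -> forall w, w \in l2 ->
    `|\sum_(y' <- l1) p1 h y y' * D y' w - D y w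
      - h * gen1 (fun y' => (y' \in l1)%:R * D y' w) y| <= c * h.
  apply: near_all_mem => y yl; apply: near_all_mem => w wl.
  exact: (transition_generator X1P (fun y' => D y' w) l1_uniq yl c0).
have small2 : \forall h \near 0^'+, forall y, y \in l1 -> forall w, w \in l2 ->
    `|\sum_(w' <- l2) p2 h w w' * D y w' - D y w
      - h * gen2 (fun w' => (w' \in l2)%:R * D y w') w| <= c * h.
  apply: near_all_mem => y yl; apply: near_all_mem => w wl.
  exact: (transition_generator X2P (D y) l2_uniq wl c0).
have [n [h0 [Hh1 Hh2]]] :=
  near0_subdivision t0 (filterI (nbhs_right_gt 0) (filterI small1 small2)).
set h := t / n.+1%:R in h0 Hh1 Hh2; have h0' := ltW h0.
have step s r : 0 <= s -> 0 <= r ->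
    `|joint (s + h) r x z - joint s (r + h) x z| <= e / t * h.
  move=> s0 r0; rewrite joint_addl// joint_addr// -sumrB.
  have -> : e / t * h =
      \sum_(y <- l1) \sum_(w <- l2) p1 s x y * p2 r z w * (e / t * h).
    under eq_bigr => y _.
      rewrite -mulr_suml -mulr_sumr (sum_transition X2P l2_uniq l2_inv)// mulr1.
      over.
    by rewrite -mulr_suml (sum_transition X1P l1_uniq l1_inv)// mul1r.
  rewrite big_seq [leRHS]big_seq.
  apply: le_trans (ler_norm_sum _ _ _) _; apply: ler_sum => y yl.
  rewrite -sumrB big_seq [leRHS]big_seq.
  apply: le_trans (ler_norm_sum _ _ _) _; apply: ler_sum => w wl.
  rewrite -mulrBr normrM ger0_norm ?mulr_ge0 ?transition_ge0//.
  rewrite ler_wpM2l ?mulr_ge0 ?transition_ge0//.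
  (* The terms [D y w] cancel, and so do the first-order terms, by [gen_duality]. *)
  have := Hh1 y yl w wl; have := Hh2 y yl w wl; rewrite gen_duality//.
  rewrite !ler_norml /c => /andP[A1 A2] /andP[B1 B2]; apply/andP; split; lra.
(* Telescoping: each step moves [h] from the first clock to the second, so the induction needs all
   [r]. *)
have steps m : forall r, 0 <= r ->
    `|joint (m%:R * h) r x z - joint 0 (r + m%:R * h) x z| <= m%:R * (e / t * h).
  elim: m => [|m IH] r r0; first by rewrite !mul0r addr0 subrr normr0.
  have mh0 : 0 <= m%:R * h by rewrite mulr_ge0.
  have := step (m%:R * h) r mh0 r0.
  have := IH (r + h) (addr_ge0 r0 h0').
  rewrite -natr1 !mulrDl !mul1r (addrAC r) -(addrA r).
  move=> A B; apply: le_trans (lerD A B).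
  by rewrite [leRHS]addrC; apply: le_trans (ler_normD _ _); rewrite subrKA.
have := steps n.+1 0 (lexx 0).
have -> : n.+1%:R * (e / t * h) = e.
  by rewrite /h; field; rewrite gt_eqF//=; lra.
by rewrite add0r (_ : n.+1%:R * h = t)// /h mulrC divfK.
Qed.

Lemma expectation_duality x z t : x \in l1 -> z \in l2 -> 0 < t ->
  ('E_(P1 x)[(fun w => D (X1 t w) z)] = 'E_(P2 z)[(fun w => D x (X2 t w))])%E.
Proof.
move=> xl zl t0; have t0' := ltW t0.
rewrite (expectation_invariant X1P l1_uniq l1_inv (D^~ z) xl t0').
rewrite (expectation_invariant X2P l2_uniq l2_inv (D x) zl t0').
by congr (_%:E); exact: transition_duality.
Qed.

End AbstractDuality.

(** * Particle conservation *)

Section Conservation.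
Context {L : nat}.
Implicit Types (eta xi ze : config L) (i j : 'I_L).

Definition particles eta : nat := \sum_i eta i.

(** With [n] particles no site holds more than [n], so functions into ['I_n.+1] list the whole
    sector. *)
Definition configs n : seq (config L) :=
  [seq [ffun i => val (f i)] : config L | f : {ffun 'I_L -> 'I_n.+1} <-
    enum {ffun 'I_L -> 'I_n.+1} & particles [ffun i => val (f i)] == n].

Lemma configs_uniq n : uniq (configs n).
Proof.
rewrite map_inj_uniq ?filter_uniq -?enumT ?enum_uniq// => f g /ffunP fg.
by apply/ffunP => i; apply/val_inj; have := fg i; rewrite !ffunE.
Qed.

Lemma mem_configs n eta : (eta \in configs n) = (particles eta == n).
Proof.
apply/mapP/eqP => [[f]|etan].
  by rewrite mem_filter => /andP[/eqP + _] ->.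
have le_n i : (eta i < n.+1)%N.
  by rewrite ltnS -etan /particles (bigD1 i)//= leq_addr.
have etaE : eta = [ffun i => val ([ffun i => Ordinal (le_n i)] i)].
  by apply/ffunP => i; rewrite !ffunE.
exists [ffun i => Ordinal (le_n i)] => //.
by rewrite mem_filter mem_enum andbT -etaE etan.
Qed.

Lemma particles_hop eta i j : (0 < eta i)%N ->
  particles (hop eta i j) = particles eta.
Proof.
(* Casting to [rat] replaces truncated subtraction by the additive [natr_hop]. *)
move=> i0; apply/eqP; rewrite -(eqr_nat rat) /particles !natr_sum.
under eq_bigr do rewrite natr_hop//.
by rewrite big_split/= sumrB !sum_natr_eq subrr addr0.
Qed.

Variables (R : realType) (q k : R).
Implicit Types f g : config L -> R.

(** Jumps from nonempty sites conserve the particle number, and those from empty sites have rate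
    0. *)
Lemma asip_generator_local f g eta :
  (forall ze, particles ze = particles eta -> f ze = g ze) ->
  asip_generator q k f eta = asip_generator q k g eta.
Proof.
move=> fg; apply: eq_bigr => i _; apply: eq_bigr => j _.
have hopE i' j' : qnum q (eta i')%:R * (f (hop eta i' j') - f eta) =
    qnum q (eta i')%:R * (g (hop eta i' j') - g eta).
  have [->|i0] := posnP (eta i'); first by rewrite qnum0 !mul0r.
  by rewrite !fg ?particles_hop.
have bondE h : asip_bond q k i j h eta =
    q `^ ((eta i)%:R - (eta j)%:R + (2 * k - 1)) * qnum q (2 * k + (eta j)%:R) *
      (qnum q (eta i)%:R * (h (hop eta i j) - h eta)) +
    q `^ ((eta i)%:R - (eta j)%:R - (2 * k - 1)) * qnum q (2 * k + (eta i)%:R) *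
      (qnum q (eta j)%:R * (h (hop eta j i) - h eta)).
  by rewrite /asip_bond; ring.
by rewrite !bondE !hopE.
Qed.

Lemma asip_generator_cst (c : R) eta :
  asip_generator q k (fun=> c) eta = 0.
Proof.
apply: big1 => i _; apply: big1 => j _.
by rewrite /asip_bond subrr !mulr0 addr0.
Qed.

Lemma asip_generatorZ (c : R) f eta :
  asip_generator q k (fun ze => c * f ze) eta = c * asip_generator q k f eta.
Proof.
rewrite /asip_generator mulr_sumr; apply: eq_bigr => i _.
rewrite mulr_sumr; apply: eq_bigr => j _.
by rewrite /asip_bond; ring.
Qed.

Lemma configs_invariant n eta : eta \in configs n ->
  asip_generator q k (fun ze => (ze \in configs n)%:R) eta = 0.
Proof.
rewrite mem_configs => /eqP etan; rewrite -(asip_generator_cst 1 eta).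
by apply: asip_generator_local => ze; rewrite mem_configs etan => ->; rewrite eqxx.
Qed.

Lemma asip_generator_restrict n f eta : eta \in configs n ->
  asip_generator q k (fun ze => (ze \in configs n)%:R * f ze) eta =
  asip_generator q k f eta.
Proof.
rewrite mem_configs => /eqP etan; apply: asip_generator_local => ze.
by rewrite mem_configs etan => ->; rewrite eqxx mul1r.
Qed.

End Conservation.

(** * Self-duality of ASIP *)

Section SelfDuality.
Context {R : realType} {q k : R} {L : nat}.
Hypotheses (q01 : 0 < q < 1) (k_gt0 : 0 < k).
Context {d1 d2 : measure_display}
  {T1 : measurableType d1} {T2 : measurableType d2}
  {P1 : config L -> probability T1 R} {X1 : R -> T1 -> config L}
  {P2 : config L -> probability T2 R} {X2 : R -> T2 -> config L}.
Hypotheses (asip1 : markov_jump_process (@asip_generator R q k L) P1 X1)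
  (asip2 : markov_jump_process (@asip_generator R q k L) P2 X2).

Lemma self_duality (D : config L -> config L -> R) (c : nat -> R) :
    (forall eta xi, D eta xi = c (particles xi) * dual_kernel q k eta xi) ->
  forall (eta xi : config L) (t : R), 0 < t ->
  ('E_(P1 eta)[(fun w => D (X1 t w) xi)] =
   'E_(P2 xi)[(fun w => D eta (X2 t w))])%E.
Proof.
move=> DE eta xi t t0.
apply: (expectation_duality asip1 asip2 (D := D)
  (configs_uniq (particles eta)) (configs_uniq (particles xi))) => //.
- exact: configs_invariant.
- exact: configs_invariant.
- move=> x z xl zl; rewrite !asip_generator_restrict//.
  have -> : D^~ z = fun y => c (particles z) * dual_kernel q k y z.
    by apply/funext => y; exact: DE.
  (* The prefactor varies with the second argument of [D], but is constant on the sector of [z], so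
     it can be pulled out of the generator. *)
  rewrite (@asip_generator_local _ _ _ _ (D x)
    (fun w => c (particles z) * dual_kernel q k x w)); last by move=> w wz; rewrite DE wz.
  by rewrite !asip_generatorZ generator_duality.
- by rewrite mem_configs.
- by rewrite mem_configs.
Qed.

End SelfDuality.

Theorem theorem5p1 (R : realType) (q k : R) (L : nat)
    (q01 : 0 < q < 1) (k_gt0 : 0 < k) (L_ge2 : (2 <= L)%N)
    (d1 d2 : measure_display)
    (T1 : measurableType d1) (T2 : measurableType d2)
    (P1 : config L -> probability T1 R) (X1 : R -> T1 -> config L)
    (P2 : config L -> probability T2 R) (X2 : R -> T2 -> config L)
    (asip1 : markov_jump_process (@asip_generator R q k L) P1 X1)
    (asip2 : markov_jump_process (@asip_generator R q k L) P2 X2) :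
  (forall (eta xi : config L) (t : R), 0 < t ->
     ('E_(P1 eta)[(fun w => asip_D q k (X1 t w) xi)] =
     'E_(P2 xi)[(fun w => asip_D q k eta (X2 t w))])%E)
  /\
  (forall (eta xi : config L) (t : R), 0 < t ->
     ('E_(P1 eta)[(fun w => asip_D' q k (X1 t w) xi)] =
     'E_(P2 xi)[(fun w => asip_D' q k eta (X2 t w))])%E).
Proof.
split.
  apply: (self_duality q01 k_gt0 asip1 asip2
    (c := fun n => q `^ (- n%:R ^+ 2))) => eta xi.
  by rewrite asip_D_dual// /particles natr_sum.
apply: (self_duality q01 k_gt0 asip1 asip2
  (c := fun n => q `^ ((1 - 2 * k) * n%:R))) => eta xi.
by rewrite asip_D'_dual// /particles natr_sum.
Qed.
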